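(* Let $X$, $Y$ be Banach spaces, let $T,S\in B(X,Y)$ and let $T$ be a Fredholm operator. Then there is an analytic generalized resolvent for the linear pencil $\lambda\mapsto T-\lambda S$ on a neighborhood of $0$ if and only if there exists a neighborhood $U$ of $0$ such that for all $\lambda\in U$, either $$\dim N(T-\lambda S)=\dim N(T)\quad\text{or}\quad \operatorname{codim} R(T-\lambda S)=\operatorname{codim} R(T).$$
   Context: All spaces are complex. $B(X,Y)$ is the Banach space of bounded linear operators from $X$ to $Y$; $N(\cdot)$ and $R(\cdot)$ denote null space and range. For an open set $U\subset\mathbb{C}$, a function $U\ni\lambda\mapsto G(\lambda)\in B(Y,X)$ is a generalized resolvent on $U$ of the linear pencil $\lambda\mapsto T-\lambda S$ if: (i) $(T-\lambda S)G(\lambda)(T-\lambda S)=T-\lambda S$ for all $\lambda\in U$; (ii) $G(\lambda)(T-\lambda S)G(\lambda)=G(\lambda)$ for all $\lambda\in U$; (iii) $G(\lambda)-G(\mu)=(\lambda-\mu)G(\lambda)SG(\mu)$ for all $\lambda,\mu\in U$. It is an analytic generalized resolvent if moreover $\lambda\mapsto G(\lambda)$ is analytic on $U$. Neighborhoods of $0$ are open subsets of $\mathbb{C}$ containing $0$. *)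

(* Defs.v *)
From HB Require Import structures.
From mathcomp Require Export all_boot all_order all_algebra.
From mathcomp Require Export all_classical all_reals all_analysis.
From mathcomp Require Export complex.

Set Implicit Arguments.
Unset Strict Implicit.
Unset Printing Implicit Defensive.

Import Order.TTheory GRing.Theory Num.Theory.
Export numFieldNormedType.Exports.

Local Open Scope classical_set_scope.
Local Open Scope ring_scope.

Section Dimension.
Context {K : numFieldType} {E : lmodType K}.

(* For subspaces W of V: the classes of the b i form a basis of V / W. *)
Definition basis_mod (W V : set E) (n : nat) (b : 'I_n -> E) : Prop :=
  [/\ forall i, V (b i),
      forall c : 'I_n -> K, W (\sum_i c i *: b i) -> forall i, c i = 0
    & forall v, V v -> exists c : 'I_n -> K, W (v - \sum_i c i *: b i)].

(* dim (V / W), with None standing for an infinite dimension. *)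
Definition quotient_dim (W V : set E) : option nat :=
  xget None (Some @` [set n | exists b : 'I_n -> E, basis_mod W V b]).

Definition dim (V : set E) : option nat := quotient_dim [set 0] V.

Definition codim (W : set E) : option nat := quotient_dim W setT.

End Dimension.

Section Operators.
Context {K : numFieldType}.

Definition null_space {X Y : lmodType K} (A : X -> Y) : set X :=
  A @^-1` [set 0].

(* The operator norm of A is at most M (for M >= 0). *)
Definition opnorm_le {X Y : normedModType K} (A : X -> Y) (M : K) : Prop :=
  forall x, `|A x| <= M * `|x|.

Definition bounded_op {X Y : normedModType K} (A : X -> Y) : Prop :=
  exists M, opnorm_le A M.

(* To be used for a bounded operator A between Banach spaces: closedness of the
   range then follows from its finite codimension. *)
Definition fredholm {X Y : lmodType K} (A : X -> Y) : Prop :=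
  dim (null_space A) != None /\ codim (range A) != None.

(* Stated over an abstract K because the canonical topology of a numFieldType is
   not found by unification when K is the concrete type R[i]. *)
Definition open_nbhs0 (U : set K) : Prop := open_nbhs (0 : K) U.

Definition pencil {X Y : lmodType K} (T S : X -> Y) (l : K) : X -> Y :=
  fun x => T x - l *: S x.

(* Local expansion in a power series with bounded operator coefficients that
   converges in the operator norm. *)
Definition analytic_on {X Y : normedModType K} (U : set K)
    (G : K -> {linear Y -> X}) : Prop :=
  forall m, U m -> exists (r : K) (A : nat -> {linear Y -> X}),
    [/\ 0 < r, forall k, bounded_op (A k)
      & forall l, U l -> `|l - m| < r ->
        forall e : K, 0 < e -> \forall n \near \oo,
          opnorm_le (fun y => G l y - \sum_(k < n) (l - m) ^+ k *: A k y) e].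

Definition generalized_resolvent {X Y : normedModType K} (T S : X -> Y)
    (U : set K) (G : K -> {linear Y -> X}) : Prop :=
  [/\ forall l, U l -> bounded_op (G l),
      forall l, U l -> pencil T S l \o G l \o pencil T S l =1 pencil T S l,
      forall l, U l -> G l \o pencil T S l \o G l =1 G l
    & forall l m, U l -> U m ->
        forall y, G l y - G m y = (l - m) *: G l (S (G m y))].

Definition analytic_generalized_resolvent {X Y : normedModType K}
    (T S : X -> Y) (U : set K) (G : K -> {linear Y -> X}) : Prop :=
  generalized_resolvent T S U G /\ analytic_on U G.

End Operators.

(* Main.v *)
From HB Require Import structures.
Require Import Defs.
From mathcomp Require Import ring lra.

Set Implicit Arguments.
Unset Strict Implicit.
Unset Printing Implicit Defensive.

Import Order.TTheory GRing.Theory Num.Theory.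
Import Normc.

Local Open Scope classical_set_scope.
Local Open Scope ring_scope.
Local Open Scope complex_scope.

(* Write P(l) = T - l S. If G is a generalized resolvent, the resolvent identity
   makes N(G(l)) independent of l, and N(G(l)) is a complement of R(P(l)); hence
   codim R(P(l)) is constant.

   Conversely, the open mapping theorem and a bounded projection onto N(T) give
   a bounded G0 with T G0 T = T and G0 T G0 = G0. For small l the operator
   G(l) = G0 (1 - l S G0)^-1 always satisfies G P G = G and the resolvent
   identity, and N(G(l)) = N(G0), R(G(l)) = R(G0). So P G vanishes exactly on
   N(G0), of dimension codim R(T), and G P is a projection with kernel of
   dimension dim N(T). If codim R(P) = codim R(T), then R(P) meets N(G0)
   trivially; if dim N(P) = dim N(T), then N(P) = N(G P). Either way P G P = P.
   Analyticity follows by iterating the resolvent identity. *)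

(** * Bases modulo a subspace *)

Section Subspaces.
Context {K : numFieldType}.

Definition subspace {E : lmodType K} (W : set E) : Prop :=
  W 0 /\ forall a x y, W x -> W y -> W (a *: x + y).

Section Closure.
Context {E : lmodType K} {W : set E} (sW : subspace W).

Lemma subspaceZ a x : W x -> W (a *: x).
Proof. by move=> Wx; rewrite -[_ *: _]addr0; apply: sW.2 => //; exact: sW.1. Qed.

Lemma subspaceD x y : W x -> W y -> W (x + y).
Proof. by move=> Wx Wy; rewrite -[x]scale1r; exact: sW.2. Qed.

Lemma subspaceN x : W x -> W (- x).
Proof. by move=> Wx; rewrite -scaleN1r; exact: subspaceZ. Qed.

Lemma subspaceB x y : W x -> W y -> W (x - y).
Proof. by move=> Wx Wy; apply: subspaceD => //; exact: subspaceN. Qed.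

Lemma subspace_sum n (f : 'I_n -> E) : (forall i, W (f i)) -> W (\sum_i f i).
Proof.
by move=> Wf; apply: (big_ind W) => //; [exact: sW.1 | exact: subspaceD].
Qed.

Lemma subspace_comb n (c : 'I_n -> K) (b : 'I_n -> E) :
  (forall i, W (b i)) -> W (\sum_i c i *: b i).
Proof. by move=> Wb; apply: subspace_sum => i; exact: subspaceZ. Qed.

End Closure.

Lemma subspace_null_space (X Y : lmodType K) (A : {linear X -> Y}) :
  subspace (null_space A).
Proof.
split=> [|a x y]; rewrite /null_space /= ?linear0 //.
by rewrite linearP => -> ->; rewrite scaler0 addr0.
Qed.

Lemma subspace_range (X Y : lmodType K) (A : {linear X -> Y}) :
  subspace (range A).
Proof.
split=> [|a _ _ [x _ <-] [y _ <-]]; first by exists 0; rewrite ?linear0.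
by exists (a *: x + y); rewrite ?linearP.
Qed.

Lemma subspace0 (E : lmodType K) : subspace [set 0 : E].
Proof. by split=> // a _ _ -> ->; rewrite /= scaler0 addr0. Qed.

End Subspaces.

Section Bases.
Context {K : numFieldType} {E : lmodType K}.
Implicit Types W V N : set E.

Definition spans_mod W V n (b : 'I_n -> E) : Prop :=
  forall v, V v -> exists c : 'I_n -> K, W (v - \sum_i c i *: b i).

Definition free_mod W n (b : 'I_n -> E) : Prop :=
  forall c : 'I_n -> K, W (\sum_i c i *: b i) -> forall i, c i = 0.

(** Row i of [M] holds coordinates of [b i] with respect to [c] modulo [W]. This turns comparisons
    of families of vectors into matrix algebra. *)
Lemma coordinate_matrix W V n m (b : 'I_n -> E) (c : 'I_m -> E) :
  subspace W -> (forall i, V (b i)) -> spans_mod W V c ->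
  exists M : 'M[K]_(n, m), forall u : 'rV[K]_n,
    W (\sum_i u 0 i *: b i - \sum_j (u *m M) 0 j *: c j).
Proof.
move=> sW Vb sc.
have [M MP] := choice (fun i => sc _ (Vb i)).
exists (\matrix_(i, j) M i j) => u.
have -> : \sum_i u 0 i *: b i - \sum_j (u *m \matrix_(i, j) M i j) 0 j *: c j
   = \sum_i u 0 i *: (b i - \sum_j M i j *: c j).
  under [RHS]eq_bigr do rewrite scalerBr scaler_sumr.
  rewrite sumrB; congr (_ - _).
  rewrite exchange_big /=; apply: eq_bigr => j _.
  rewrite mxE scaler_suml; apply: eq_bigr => i _.
  by rewrite mxE scalerA.
exact: subspace_comb.
Qed.

(** The square coordinate matrix of [b] over the basis [c] has trivial kernel because [b] is free,
    so it is invertible. Coordinates over [b] are those over [c] times its inverse. *)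
Lemma basis_mod_free_spans W V n (b c : 'I_n -> E) :
  subspace W -> basis_mod W V c -> (forall i, V (b i)) ->
  free_mod W b -> spans_mod W V b.
Proof.
move=> sW [Vc _ sc] Vb fb v Vv.
have [M MP] := coordinate_matrix sW Vb sc.
have uM : M \in unitmx.
  rewrite -row_free_unit -kermx_eq0; apply/rowV0P => u /sub_kermxP uM0.
  apply/rowP => i; rewrite mxE; apply: (fb (fun i => u 0 i)).
  by have := MP u; rewrite uM0 [X in _ - X]big1 ?subr0 // => j _; rewrite mxE scale0r.
have [a aP] := sc v Vv.
exists (fun i => (\row_j a j *m invmx M) 0 i).
have := subspaceB sW aP (MP (\row_j a j *m invmx M)).
rewrite mulmxKV // [X in _ - (_ - X)](eq_bigr (fun i => a i *: c i)); last first.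
  by move=> i _; rewrite mxE.
by rewrite opprB addrA subrK.
Qed.

(** Passing from [c] to [b] and back is the identity because [c] is free, so [N *m M = 1]. The
    matrices being square, also [M *m N = 1], and a relation [u] among the [b i] satisfies
    [u *m M = 0], hence [u = 0]. *)
Lemma basis_mod_spans_free W V n (b c : 'I_n -> E) :
  subspace W -> basis_mod W V c -> (forall i, V (b i)) ->
  spans_mod W V b -> free_mod W b.
Proof.
move=> sW [Vc fc sc] Vb sb a Wa.
have [M MP] := coordinate_matrix sW Vb sc.
have [N NP] := coordinate_matrix sW Vc sb.
have NM : N *m M = 1%:M.
  apply/row_matrixP => i; rewrite row1 rowE; set u := delta_mx _ _.
  apply/rowP => j; apply/eqP; rewrite mulmxA eq_sym -subr_eq0; apply/eqP.
  apply: (fc (fun j => u 0 j - (u *m N *m M) 0 j)).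
  under eq_bigr do rewrite scalerBl.
  rewrite sumrB; have := subspaceD sW (NP u) (MP (u *m N)).
  by rewrite addrA subrK.
have MN := mulmx1C NM.
pose u : 'rV_n := \row_i a i.
have uM0 : u *m M = 0.
  apply/rowP => j; rewrite [RHS]mxE; apply: (fc (fun j => (u *m M) 0 j)).
  have := subspaceB sW Wa (MP u).
  rewrite [X in _ - (X - _)](eq_bigr (fun i => a i *: b i)); last first.
    by move=> i _; rewrite mxE.
  by rewrite opprB addrC subrK.
move=> i; have /rowP/(_ i) : u = 0 by rewrite -[u]mulmx1 -MN mulmxA uM0 mul0mx.
by rewrite !mxE.
Qed.

Lemma quotient_dim_basis W V n :
  quotient_dim W V = Some n -> exists b : 'I_n -> E, basis_mod W V b.
Proof.
rewrite /quotient_dim; case: xgetP => // x _ [m [b bP] <-] [<-].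
by exists b.
Qed.

Lemma quotient_dim_neq_None W V :
  quotient_dim W V != None -> exists n, quotient_dim W V = Some n.
Proof. by case: quotient_dim => // n _; exists n. Qed.

Definition complements W N : Prop :=
  (forall v, exists2 z, N z & W (v - z)) /\ (forall z, W z -> N z -> z = 0).

(* A basis modulo one complement of N can be moved into N, where it is a basis
   of N and hence a basis modulo any other complement. *)
Lemma basis_in_complement W N n (b : 'I_n -> E) :
  subspace W -> subspace N -> complements W N -> basis_mod W setT b ->
  exists2 b' : 'I_n -> E, forall i, N (b' i) &
    free_mod W b' /\ spans_mod [set 0] N b'.
Proof.
move=> sW sN [WN WN0] [_ fb sb].
have WNb i : exists z, N z /\ W (b i - z) by have [z] := WN (b i); exists z.
have [b' b'P] := choice WNb.
have Wd c : W (\sum_i c i *: b i - \sum_i c i *: b' i).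
  rewrite -sumrB; apply: (subspace_sum sW) => i; rewrite -scalerBr.
  by apply: (subspaceZ sW); exact: (b'P i).2.
exists b' => [i|]; first exact: (b'P i).1.
split=> [c Wc|z Nz].
  by apply: fb; have := subspaceD sW (Wd c) Wc; rewrite subrK.
have [c Wc] := sb z I; exists c; apply: WN0.
  by have := subspaceD sW Wc (Wd c); rewrite addrA subrK.
by apply: (subspaceB sN) => //; apply: (subspace_comb sN) => i; exact: (b'P i).1.
Qed.

(** Both quotients are represented by [N]: a basis modulo one subspace, moved into [N], is a basis
    modulo the other. The sets of admissible dimensions thus coincide, and so do the values [xget]
    picks, [None] included. *)
Lemma complements_codim W1 W2 N :
  subspace W1 -> subspace W2 -> subspace N ->
  complements W1 N -> complements W2 N -> codim W1 = codim W2.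
Proof.
have aux U1 U2 n : subspace U1 -> subspace U2 -> subspace N ->
  complements U1 N -> complements U2 N ->
  (exists b : 'I_n -> E, basis_mod U1 setT b) ->
  exists b : 'I_n -> E, basis_mod U2 setT b.
  move=> s1 s2 sN c1 c2 [b bb].
  have [b' Nb' [fb' sb']] := basis_in_complement s1 sN c1 bb.
  exists b'; split=> // [c Uc|v _].
    apply: fb'; have -> : \sum_i c i *: b' i = 0; last exact: s1.1.
    by apply: c2.2 => //; exact: subspace_comb.
  have [z Nz Uz] := c2.1 v; have [c /eqP] := sb' z Nz.
  by rewrite subr_eq0 => /eqP zc; exists c; rewrite -zc.
move=> s1 s2 sN c1 c2; rewrite /codim /quotient_dim; congr (xget _ (_ @` _)).
by apply/seteqP; split=> n /=; exact: aux.
Qed.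

(** A basis of [N] has as many elements as the codimension of [W2] and spans modulo [W2], so it is
    free modulo [W2]. No nonzero combination of it can then fall into [W2]. *)
Lemma trivial_meet_of_codim W1 W2 N :
  subspace W1 -> subspace W2 -> subspace N -> complements W1 N ->
  (forall v, exists2 z, N z & W2 (v - z)) ->
  codim W1 != None -> codim W2 = codim W1 -> forall z, W2 z -> N z -> z = 0.
Proof.
move=> s1 s2 sN c1 W2N /quotient_dim_neq_None[n cn]; rewrite /codim cn.
move=> /quotient_dim_basis[c bc]; have [b bb] := quotient_dim_basis cn.
have [b' Nb' [_ sb']] := basis_in_complement s1 sN c1 bb.
have fb' : free_mod W2 b'.
  apply: (basis_mod_spans_free s2 bc) => // v _.
  have [z Nz Wz] := W2N v; have [a /eqP] := sb' z Nz.
  by rewrite subr_eq0 => /eqP za; exists a; rewrite -za.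
move=> z Wz Nz; have [a /eqP] := sb' z Nz; rewrite subr_eq0 => /eqP za.
rewrite za big1 // => i _; rewrite fb' ?scale0r //.
by rewrite -za.
Qed.

End Bases.

(** The map [f] sends a basis of [V2] to a free family in [V1] of full size, which therefore spans
    [V1]. So [f x] is a combination of it for every [x] in [V3], and injectivity on [V3] puts [x] in
    [V2]. *)
Lemma subset_of_dim (K : numFieldType) (E F : lmodType K) (f : {linear E -> F})
    (V1 : set F) (V2 V3 : set E) :
  subspace V2 -> subspace V3 -> V2 `<=` V3 ->
  (forall x, V3 x -> V1 (f x)) -> (forall x, V3 x -> f x = 0 -> x = 0) ->
  dim V1 != None -> dim V2 = dim V1 -> V3 `<=` V2.
Proof.
move=> s2 s3 s23 fV f0 /quotient_dim_neq_None[n dn]; rewrite /dim dn.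
move=> /quotient_dim_basis[a [Va fa sa]]; have [c bc] := quotient_dim_basis dn.
have fcomb (u : 'I_n -> K) : f (\sum_i u i *: a i) = \sum_i u i *: f (a i).
  by rewrite linear_sum; apply: eq_bigr => i _; rewrite linearZ.
have Va3 u : V3 (\sum_i u i *: a i).
  by apply: (subspace_comb s3) => i; apply: s23.
have sf := basis_mod_free_spans (subspace0 F) bc
  (fun i => fV _ (s23 _ (Va i))) _.
move=> x V3x; have [|u] := sf _ (f x) (fV _ V3x).
  by move=> u u0 i; apply: fa => /=; apply: f0 => //; rewrite fcomb.
rewrite /= -fcomb -linearB => /f0 x0.
have /eqP : x - \sum_i u i *: a i = 0 by apply: x0; exact: subspaceB.
by rewrite subr_eq0 => /eqP ->; exact: subspace_comb.
Qed.

(** * Hahn-Banach *)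

Section RealNorms.
Context {R : realType}.

(** Norms of normed modules over [R[i]] take values in [R[i]], whose order is partial. Real values
    give access to suprema and [lra]. *)
Record norm_on (E : lmodType R[i]) (nE : E -> R) : Prop := NormOn {
  norm_onD : forall x y, nE (x + y) <= nE x + nE y;
  norm_onZ : forall c x, nE (c *: x) = normc c * nE x;
  norm_on_eq0 : forall x, nE x = 0 -> x = 0 }.

Lemma normc_real (r : R) : normc r%:C = `|r|.
Proof. by rewrite /normc /= expr0n addr0 sqrtr_sqr. Qed.

Lemma normc_ge0 (c : R[i]) : 0 <= normc c.
Proof. by case: c => a b; exact: sqrtr_ge0. Qed.

Lemma normci : normc ('i : R[i]) = 1.
Proof. by rewrite /normc expr0n expr1n add0r sqrtr1. Qed.

Section Norm.
Context {E : lmodType R[i]} {nE : E -> R} (nP : norm_on nE).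

Lemma norm_onN x : nE (- x) = nE x.
Proof. by rewrite -scaleN1r norm_onZ // normcN normc1 mul1r. Qed.

Lemma norm_on0 : nE 0 = 0.
Proof. by rewrite -(scale0r 0) norm_onZ // normc0 mul0r. Qed.

Lemma norm_on_ge0 x : 0 <= nE x.
Proof.
have := norm_onD nP x (- x); rewrite subrr norm_on0 norm_onN; lra.
Qed.

Lemma norm_on_gt0 x : x != 0 -> 0 < nE x.
Proof.
move=> x0; rewrite lt0r norm_on_ge0 andbT.
by apply: contra x0 => /eqP/(norm_on_eq0 nP)->.
Qed.

Lemma norm_onB x y : nE (x - y) = nE (y - x).
Proof. by rewrite -norm_onN opprB. Qed.

Lemma norm_on_trans z x y : nE (x - y) <= nE (x - z) + nE (z - y).
Proof. by rewrite -{1}(subrK z x) -addrA; exact: norm_onD. Qed.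

End Norm.

Section HahnBanach.
Context {E : lmodType R[i]} {nE : E -> R} (nP : norm_on nE).

(* A real-linear functional on a real subspace, given by its graph. *)
Definition dominated_graph (A : set (E * R)) : Prop :=
  (forall r p q, A p -> A q -> A (r%:C *: p.1 + q.1, r * p.2 + q.2)) /\
  (forall p, A p -> p.2 <= nE p.1).

(** The value [c] at [x0] has to lie above all [p.2 - nE (p.1 - x0)] and below all
    [nE (q.1 + x0) - q.2]. The triangle inequality makes these bounds compatible, and the supremum
    of the lower ones serves. *)
Lemma dominated_graph_extend A x0 : dominated_graph A -> A !=set0 ->
  exists c, dominated_graph
    [set p | exists q t, A q /\ p = (q.1 + t%:C *: x0, q.2 + t * c)].
Proof.
move=> [Alin Adom] [q0 Aq0].
have A2 p q : A p -> A q -> p.2 - nE (p.1 - x0) <= nE (q.1 + x0) - q.2.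
  move=> Ap Aq; have := Adom _ (Alin 1 _ _ Ap Aq); rewrite /= scale1r mul1r.
  have := norm_onD nP (p.1 - x0) (q.1 + x0).
  rewrite addrACA addNr addr0; lra.
pose B : set R := [set p.2 - nE (p.1 - x0) | p in A].
have supB : has_sup B.
  split; first by exists (q0.2 - nE (q0.1 - x0)); exists q0.
  by exists (nE (q0.1 + x0) - q0.2) => _ [p Ap <-]; exact: A2.
have cl p : A p -> p.2 - nE (p.1 - x0) <= sup B.
  by move=> Ap; apply: ub_le_sup; [exact: supB.2 | exists p].
have cu q : A q -> sup B <= nE (q.1 + x0) - q.2.
  by move=> Aq; apply: ge_sup; [exact: supB.1 | move=> _ [p Ap <-]; exact: A2].
move: (sup B) cl cu => c cl cu.
have A0 : A (0, 0).
  have := Alin (-1) _ _ Aq0 Aq0.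
  by rewrite rmorphN1 scaleN1r mulN1r !addNr.
have AZ r q : A q -> A (r%:C *: q.1, r * q.2).
  by move=> Aq; have := Alin r _ _ Aq A0; rewrite !addr0.
exists c; split=> [r _ _ [p [t [Ap ->]]] [q [s [Aq ->]]]|_ [q [t [Aq ->]]]].
  exists (r%:C *: p.1 + q.1, r * p.2 + q.2), (r * t + s); split; first exact: Alin.
  rewrite /= rmorphD rmorphM scalerDr scalerDl scalerA; congr (_, _).
    by rewrite addrACA.
  by ring.
(* Dividing by the absolute value of [t] reduces to the coefficients -1 and 1, that is, to the lower
   and the upper bound on [c]. *)
rewrite /=; have [t0|t0|->] := ltgtP t 0.
- have := cl _ (AZ (- t)^-1 _ Aq); rewrite /=.
  have -> : (- t)^-1%:C *: q.1 - x0 = (- t)^-1%:C *: (q.1 + t%:C *: x0).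
    rewrite scalerDr scalerA -rmorphM invrN mulNr mulVf ?lt_eqF//.
    by rewrite rmorphN1 scaleN1r.
  rewrite norm_onZ // normc_real ger0_norm; last by rewrite invr_ge0; lra.
  rewrite -mulrBr mulrC ler_pdivrMr ?oppr_gt0//; lra.
- have := cu _ (AZ t^-1 _ Aq); rewrite /=.
  have -> : t^-1%:C *: q.1 + x0 = t^-1%:C *: (q.1 + t%:C *: x0).
    rewrite scalerDr scalerA -rmorphM mulVf ?gt_eqF//.
    by rewrite rmorph1 scale1r.
  rewrite norm_onZ // normc_real ger0_norm; last by rewrite invr_ge0; lra.
  rewrite -mulrBr mulrC ler_pdivlMr//; lra.
- by rewrite rmorph0 scale0r mul0r !addr0; exact: Adom.
Qed.

Lemma hahn_banach_real (v : E) : exists u : E -> R,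
  [/\ forall r x y, u (r%:C *: x + y) = r * u x + u y,
      forall x, u x <= nE x & u v = nE v].
Proof.
pose A0 : set (E * R) := [set p | exists t, p = (t%:C *: v, t * nE v)].
have dA0 : dominated_graph A0.
  split=> [r _ _ [t ->] [s ->]|_ [t ->]] /=.
    exists (r * t + s); rewrite rmorphD rmorphM scalerDl scalerA.
    by congr (_, _); ring.
  rewrite norm_onZ // normc_real; apply: ler_wpM2r; first exact: norm_on_ge0.
  exact: ler_norm.
(* Containing [A0] is required of nonempty graphs only, because the union of the empty chain must
   satisfy [P] as well. *)
pose P : set (set (E * R)) :=
  [set A | dominated_graph A /\ (A !=set0 -> A0 `<=` A)].
have [F FP Ftot|A [[dA AA0] Amax]] := @Zorn_bigcup _ P.
  split; last first.
    move=> [p [B FB Bp]]; apply: subset_trans (bigcup_sup FB).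
    by apply: (FP _ FB).2; exists p.
  split=> [r p q [B FB Bp] [D FD Dq]|p [B FB]]; last exact: (FP _ FB).1.2.
  have [BD|DB] := Ftot _ _ FB FD.
    by exists D => //; apply: (FP _ FD).1.1 => //; exact: BD.
  by exists B => //; apply: (FP _ FB).1.1 => //; exact: DB.
have A0A : A0 `<=` A.
  apply: AA0; apply: contrapT => Ane; apply: (Amax A0); last by split=> // _.
  split=> [p Ap|/(_ (v, nE v)) A0A]; first by case: Ane; exists p.
  apply: Ane; exists (v, nE v); apply: A0A.
  by exists 1; rewrite rmorph1 scale1r mul1r.
have A00 : A (0, 0) by apply: A0A; exists 0; rewrite rmorph0 scale0r mul0r.
(* A point outside the domain would allow a strictly larger dominated graph, against maximality. *)
have Atot x : exists a, A (x, a).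
  apply: contrapT => nx.
  have [c dc] := @dominated_graph_extend A x dA (ex_intro _ _ A00).
  set A' := [set p | _] in dc.
  have AA' : A `<=` A'.
    move=> p Ap; exists p, 0; split=> //.
    by rewrite rmorph0 scale0r mul0r !addr0; case: p {Ap}.
  apply: (Amax A'); last by split=> // _; apply: subset_trans AA'.
  split=> // /(_ (x, c)) A'A; apply: nx; exists c; apply: A'A.
  by exists (0, 0), 1; split=> //=; rewrite rmorph1 scale1r mul1r !add0r.
have [u uP] := choice Atot.
(* The graph is single-valued: it contains [(0, a - b)], and domination bounds [a - b] by the norm
   of 0. *)
have Auniq x a b : A (x, a) -> A (x, b) -> a <= b.
  move=> Aa Ab; have := dA.2 _ (dA.1 (-1) _ _ Ab Aa).
  by rewrite /= rmorphN1 scaleN1r addNr norm_on0 //; lra.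
exists u; split=> [r x y|x|].
- have h := dA.1 r _ _ (uP x) (uP y).
  by apply/eqP; rewrite eq_le !(Auniq _ _ _ h (uP _), Auniq _ _ _ (uP _) h).
- exact: dA.2 (uP x).
- have h : A (v, nE v) by apply: A0A; exists 1; rewrite rmorph1 scale1r mul1r.
  by apply/eqP; rewrite eq_le !(Auniq _ _ _ h (uP _), Auniq _ _ _ (uP _) h).
Qed.

(** From a real functional [u] one gets the complex-linear functional with real part [u x] and
    imaginary part [- u ('i *: x)]. It is nonzero at [v], where its real part is [nE v], so it can
    be normalized there. *)
Lemma hahn_banach_point (v : E) : v != 0 -> exists (g : E -> R[i]) (M : R),
  [/\ 0 <= M, forall a x y, g (a *: x + y) = a * g x + g y,
      forall x, normc (g x) <= M * nE x & g v = 1].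
Proof.
move=> v0; have [u [ulin udom uv]] := hahn_banach_real v.
have uD x y : u (x + y) = u x + u y.
  by have := ulin 1 x y; rewrite rmorph1 scale1r mul1r.
have u0 : u 0 = 0 by have := uD 0 0; rewrite addr0; lra.
have uZ r x : u (r%:C *: x) = r * u x.
  by have := ulin r x 0; rewrite u0 !addr0.
have uN x : u (- x) = - u x.
  by have := uZ (-1) x; rewrite rmorphN1 scaleN1r mulN1r.
have nu x : `|u x| <= nE x.
  by rewrite ler_norml udom andbT lerNl -uN -(norm_onN nP); exact: udom.
pose g x := u x +i* - u ('i *: x).
have g_lin a x y : g (a *: x + y) = a * g x + g y.
  case: a => a b.
  have -> : (a +i* b) *: x = a%:C *: x + b%:C *: ('i *: x).
    by rewrite scalerA -scalerDl; congr (_ *: _); simpc.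
  rewrite /g !scalerDr !scalerA.
  have -> : 'i * a%:C = a%:C * 'i :> R[i] by rewrite mulrC.
  have -> : 'i * (b%:C * 'i) = (- b)%:C :> R[i] by simpc.
  rewrite -!scalerA !uD !uZ; simpc; apply/eqP; rewrite eq_complex /=.
  by apply/andP; split; apply/eqP; ring.
have gb x : normc (g x) <= 2 * nE x.
  have -> : g x = (u x)%:C + (- u ('i *: x))%:C * 'i by rewrite /g; simpc.
  apply: (le_trans (le_normcD _ _)).
  rewrite normcM !normc_real normrN.
  rewrite normci mulr1; have := nu x; have := nu ('i *: x).
  have -> : nE ('i *: x) = nE x by rewrite (norm_onZ nP) normci mul1r.
  by move: `|u x| `|u _| => *; lra.
have gv : g v != 0.
  by rewrite eq_complex negb_and /= uv gt_eqF // norm_on_gt0.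
exists (fun x => (g v)^-1 * g x), (normc (g v)^-1 * 2); split.
- by rewrite mulr_ge0 ?normc_ge0.
- by move=> a x y; rewrite g_lin mulrDr mulrCA.
- by move=> x; rewrite normcM -mulrA ler_wpM2l ?normc_ge0.
- by rewrite mulVf.
Qed.

(** Induction in Gram-Schmidt fashion: [v] is the part of the new vector missed by the projection
    [p] onto the others. If [v] is nonzero, a functional [g] with [g v = 1] corrects [p] by
    [g (x - p x) *: v], which vanishes wherever [p x = x]. *)
Lemma bounded_projection n (e : 'I_n -> E) : exists (p : E -> E) (M : R),
  [/\ 0 <= M, linear p, forall x, nE (p x) <= M * nE x &
   (forall x, exists c : 'I_n -> R[i], p x = \sum_i c i *: e i) /\
   forall i, p (e i) = e i].
Proof.
elim: n e => [|n IH] e.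
  exists (fun=> 0), 0; split=> //.
  - by move=> a x y; rewrite scaler0 addr0.
  - by move=> x; rewrite norm_on0 // mul0r.
  - by split=> [x|[]//]; exists (fun=> 0); rewrite big_ord0.
have [p [M [M0 plin pb [pr pe]]]] := IH (fun i => e (lift ord0 i)).
have pe' i : i != ord0 -> p (e i) = e i.
  by case: (unliftP ord0 i) => [j ->|->] //; rewrite eqxx.
pose v := e ord0 - p (e ord0).
have [v0|v0] := eqVneq v 0.
  exists p, M; split=> //; split=> [x|i].
    have [c ->] := pr x; exists (fun i => oapp c 0 (unlift ord0 i)).
    rewrite big_ord_recl /= unlift_none /= scale0r add0r.
    by apply: eq_bigr => i _; rewrite liftK.
  have [->|i0] := eqVneq i ord0; last exact: pe'.
  by apply/esym/eqP; rewrite -subr_eq0; apply/eqP.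
have [g [L [L0 glin gb gv]]] := hahn_banach_point v0.
have gB x : g (x - p x) = g x - g (p x).
  by have := glin (-1) (p x) x; rewrite scaleN1r mulN1r addrC [RHS]addrC.
exists (fun x => p x + g (x - p x) *: v), (M + L * (1 + M) * nE v); split.
- by rewrite addr_ge0 // !mulr_ge0 // ?addr_ge0 // norm_on_ge0.
- move=> a x y; rewrite !gB plin !glin.
  rewrite [a *: (_ + _)]scalerDr [RHS]addrACA; congr (_ + _).
  by rewrite scalerA -scalerDl; congr (_ *: _); ring.
- move=> x; apply: (le_trans (norm_onD nP _ _)).
  rewrite mulrDl lerD // norm_onZ // mulrAC; apply: ler_wpM2r.
    exact: norm_on_ge0.
  apply: (le_trans (gb _)); rewrite -mulrA; apply: ler_wpM2l => //.
  apply: (le_trans (norm_onD nP _ _)); rewrite norm_onN // mulrDl mul1r.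
  by rewrite lerD2l.
- split=> [x|i].
    have [c pc] := pr x; have [d pd] := pr (e ord0).
    pose k := g (x - p x).
    (* As [v] is [e ord0] minus the combination with coefficients [d], adding [k *: v] changes each
       [c j] by [- k * d j]. *)
    exists (fun i => oapp (fun j => c j - k * d j) k (unlift ord0 i)).
    rewrite big_ord_recl /= unlift_none /= -/k /v scalerBr pc pd.
    rewrite addrCA; congr (_ + _); rewrite scaler_sumr -sumrB.
    by apply: eq_bigr => i _; rewrite liftK /= scalerBl scalerA.
  have [->|i0] := eqVneq i ord0; first by rewrite gv scale1r addrC subrK.
  rewrite pe' // subrr.
  have -> : g 0 = 0 by have := glin (-1) 0 0; rewrite scaler0 addr0 mulN1r addNr.
  by rewrite scale0r addr0.
Qed.

End HahnBanach.
End RealNorms.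

(** * Open mapping *)

Section Complete.
Context {R : realType}.

Lemma halfX_gt0 k : 0 < (2^-1 : R) ^+ k.
Proof. by rewrite exprn_gt0 // invr_gt0 ltr0n. Qed.

Lemma halfX_le1 k : (2^-1 : R) ^+ k <= 1.
Proof. by rewrite exprn_ile1 //; lra. Qed.

(** Serves for passing to the limit in norm estimates. If [b < a], any natural number k above
    [c / (a - b)] gives a contradiction, since k is less than the k-th power of 2. *)
Lemma le_halfX_lim (a b c : R) :
  (forall k, a <= b + c * 2^-1 ^+ k) -> a <= b.
Proof.
move=> h; rewrite leNgt; apply/negP => ba.
have c0 : 0 < c by have := h 0; rewrite expr0; lra.
have ab : 0 < a - b by lra.
have := h (Num.bound (c / (a - b))); set k := Num.bound _.
have ck : c / (a - b) < k%:R.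
  by rewrite archi_boundP // divr_ge0 // ltW.
have k2 : k%:R < 2 ^+ k :> R by rewrite -natrX ltr_nat ltn_expl.
have : c < (a - b) * 2 ^+ k by rewrite mulrC -ltr_pdivrMr //; exact: lt_trans k2.
rewrite -ltr_pdivrMr ?exprn_gt0 // exprVn; lra.
Qed.

(* Completeness, tested on sequences with geometrically decreasing steps. *)
Definition complete_norm (E : lmodType R[i]) (nE : E -> R) : Prop :=
  forall (u : nat -> E) (M : R),
    (forall k, nE (u k.+1 - u k) <= M * 2^-1 ^+ k) ->
    exists l N, forall k, nE (l - u k) <= N * 2^-1 ^+ k.

(** With [d k] the geometric sum of all steps from [k] on, the intervals of centre [u k] and radius
    [d k] are nested. The supremum of their left ends lies in all of them. *)
Lemma complete_real (u : nat -> R) (M : R) :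
  (forall k, `|u k.+1 - u k| <= M * 2^-1 ^+ k) ->
  exists l, forall k, `|l - u k| <= 2 * M * 2^-1 ^+ k.
Proof.
move=> uM; pose d k := 2 * M * (2^-1 : R) ^+ k.
have dS k : d k = M * 2^-1 ^+ k + d k.+1.
  by rewrite /d exprS; field.
have d0 k : 0 <= d k.
  rewrite /d -mulrA; apply: mulr_ge0 => //; exact: le_trans (uM k).
have uS k : u k - d k <= u k.+1 - d k.+1 /\ u k.+1 + d k.+1 <= u k + d k.
  by have := uM k; rewrite (dS k) ler_norml => /andP[]; lra.
have mono j k : u k - d k <= u (k + j)%N - d (k + j)%N /\
    u (k + j)%N + d (k + j)%N <= u k + d k.
  elim: j => [|j [IH1 IH2]]; first by rewrite addn0.
  by rewrite addnS; have := uS (k + j)%N; lra.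
have le2 j k : u j - d j <= u k + d k.
  have [h1 _] := mono k j; have [_ h2] := mono j k; have := d0 (j + k)%N.
  by rewrite addnC in h2; lra.
pose B : set R := range (fun k => u k - d k).
exists (sup B) => k; rewrite ler_norml -/(d k); apply/andP; split.
  have : u k - d k <= sup B.
    by apply: ub_le_sup; [exists (u 0 + d 0) => _ [j _ <-] | exists k].
  by lra.
have : sup B <= u k + d k.
  apply: ge_sup; first by exists (u k - d k); exists k.
  by move=> _ [j _ <-].
by lra.
Qed.

Lemma Re_le_normc (z : R[i]) : `|complex.Re z| <= normc z.
Proof.
by case: z => a b; rewrite /normc /= -sqrtr_sqr ler_wsqrtr // lerDl sqr_ge0.
Qed.

Lemma Im_le_normc (z : R[i]) : `|complex.Im z| <= normc z.
Proof.
by case: z => a b; rewrite /normc /= -sqrtr_sqr ler_wsqrtr // lerDr sqr_ge0.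
Qed.

Lemma normc_le_ReIm (z : R[i]) : normc z <= `|complex.Re z| + `|complex.Im z|.
Proof.
rewrite {1}(complexE z) -!normc_real; apply: (le_trans (le_normcD _ _)).
by rewrite normcM normci mul1r.
Qed.

Lemma norm_on_row m : norm_on (fun c : 'rV[R[i]]_m => \sum_i normc (c 0 i)).
Proof.
split=> [x y|c x|x].
- rewrite -big_split; apply: ler_sum => i _; rewrite mxE; exact: le_normcD.
- by rewrite mulr_sumr; apply: eq_bigr => i _; rewrite mxE normcM.
- move=> /eqP; rewrite psumr_eq0; last by move=> i _; exact: normc_ge0.
  move=> /allP h; apply/rowP => i; rewrite mxE.
  by apply: eq0_normc; apply/eqP; exact: (implyP (h i (mem_index_enum i))).
Qed.

Lemma complete_row m : complete_norm (fun c : 'rV[R[i]]_m => \sum_i normc (c 0 i)).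
Proof.
move=> u M uM.
have cM i k : normc (u k.+1 0 i - u k 0 i) <= M * 2^-1 ^+ k.
  apply: le_trans (uM k); rewrite (bigD1 i) //= !mxE lerDl.
  by apply: sumr_ge0 => j _; exact: normc_ge0.
have ReB (a b : R[i]) : complex.Re (a - b) = complex.Re a - complex.Re b.
  by case: a b => ? ? [].
have ImB (a b : R[i]) : complex.Im (a - b) = complex.Im a - complex.Im b.
  by case: a b => ? ? [].
(* The real and the imaginary part each contribute [2 * M]. *)
have lP i : exists z, forall k, normc (z - u k 0 i) <= 4 * M * 2^-1 ^+ k.
  have [k|a aP] := @complete_real (fun k => complex.Re (u k 0 i)) M.
    by rewrite -ReB; exact: le_trans (Re_le_normc _) (cM i k).
  have [k|b bP] := @complete_real (fun k => complex.Im (u k 0 i)) M.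
    by rewrite -ImB; exact: le_trans (Im_le_normc _) (cM i k).
  exists (a +i* b) => k; apply: (le_trans (normc_le_ReIm _)).
  by rewrite ReB ImB /=; have := aP k; have := bP k; lra.
have [l {}lP] := choice lP.
exists (\row_i l i), (\sum_(i < m) 4 * M) => k.
by rewrite mulr_suml; apply: ler_sum => i _; rewrite !mxE.
Qed.

Section Product.
Context {E F : lmodType R[i]} {nE : E -> R} {nF : F -> R}.

Lemma norm_on_prod : norm_on nE -> norm_on nF ->
  norm_on (fun p : (E * F)%type => nE p.1 + nF p.2).
Proof.
move=> nEP nFP; split=> [x y|c x|[x y] /= h].
- by have := norm_onD nEP x.1 y.1; have := norm_onD nFP x.2 y.2; rewrite /=; lra.
- by rewrite /= !norm_onZ // mulrDr.
- have := norm_on_ge0 nEP x; have := norm_on_ge0 nFP y => y0 x0.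
  have -> : x = 0 by apply: (norm_on_eq0 nEP); lra.
  by have -> : y = 0 by apply: (norm_on_eq0 nFP); lra.
Qed.

Lemma complete_prod : norm_on nE -> norm_on nF ->
  complete_norm nE -> complete_norm nF ->
  complete_norm (fun p : (E * F)%type => nE p.1 + nF p.2).
Proof.
move=> nEP nFP cE cF u M uM.
have [k|a [N1 aP]] := cE (fun k => (u k).1) M.
  by have := uM k; have := norm_on_ge0 nFP (u k.+1 - u k).2; rewrite /=; lra.
have [k|b [N2 bP]] := cF (fun k => (u k).2) M.
  by have := uM k; have := norm_on_ge0 nEP (u k.+1 - u k).1; rewrite /=; lra.
by exists (a, b), (N1 + N2) => k; have := aP k; have := bP k; rewrite /=; lra.
Qed.

End Product.

Section OpenMapping.
Context {E F : lmodType R[i]} {nE : E -> R} {nF : F -> R}.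
Hypotheses (nEP : norm_on nE) (nFP : norm_on nF).
Hypotheses (cE : complete_norm nE) (cF : complete_norm nF).
Variables (A : {linear E -> F}) (L : R).
Hypotheses (L0 : 0 <= L) (AL : forall x, nF (A x) <= L * nE x).
Hypothesis (Asurj : forall y, exists x, A x = y).

(* Baire: otherwise nested balls avoiding the images of larger and larger balls
   shrink to a point outside the range of A. *)
Lemma image_ball_somewhere_dense : exists (k : nat) (y0 : F) (r : R),
  0 < r /\ forall y, nF (y - y0) <= r -> forall e, 0 < e ->
    exists x, nE x <= k%:R /\ nF (y - A x) <= e.
Proof.
apply: contrapT => nh.
(* A pair in [F * R] is a ball, given by centre and radius. The ball [q] lies in the ball of [p] and
   misses the image of the ball of radius [p.1]. Positivity is a premise inside the existential so
   that [choice] yields a total function. *)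
have step (p : nat * (F * R)) : exists q : F * R, 0 < p.2.2 ->
    [/\ 0 < q.2, q.2 <= p.2.2 / 2, nF (q.1 - p.2.1) <= p.2.2 / 2 &
        forall x, nE x <= p.1%:R -> q.2 < nF (q.1 - A x)].
  case: p => k [y0 r] /=; have [r0|r0] := ltP 0 r; last first.
    by exists (y0, r) => /=; lra.
  have [y yP] : exists y, nF (y - y0) <= r / 2 /\ exists2 e, 0 < e &
      forall x, nE x <= k%:R -> e < nF (y - A x).
    apply: contrapT => ny; apply: nh; exists k, y0, (r / 2); split; first by lra.
    move=> y yr e e0; apply: contrapT => nx; apply: ny; exists y; split=> //.
    exists e => // x xk; rewrite ltNge; apply/negP => xe.
    by apply: nx; exists x.
  case: yP => yr [e e0 eP]; exists (y, Num.min e (r / 2)) => _ /=; split=> //.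
  - by rewrite lt_min e0 /=; lra.
  - by rewrite ge_min lexx orbT.
  - by move=> x /eP; apply: le_lt_trans; rewrite ge_min lexx.
have [f fP] := choice step.
pose s := fix s k : F * R := if k is j.+1 then f (j, s j) else (0, 1).
have s0 k : 0 < (s k).2.
  by elim: k => [|k IH] //=; have [] := fP (k, s k) IH.
have sP k : [/\ (s k.+1).2 <= (s k).2 / 2, nF ((s k.+1).1 - (s k).1) <= (s k).2 / 2 &
    forall x, nE x <= k%:R -> (s k.+1).2 < nF ((s k.+1).1 - A x)].
  by have [] := fP (k, s k) (s0 k).
have shalf k : (s k).2 <= 2^-1 ^+ k.
  elim: k => [|k IH]; first by rewrite expr0.
  by have [h _ _] := sP k; rewrite exprS; lra.
have [k|l [N lP]] := cF (u := fun k => (s k).1) (M := 1).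
  by have [_ h _] := sP k; have := shalf k; have := s0 k; lra.
have snest j k : nF ((s (k + j)%N).1 - (s k).1) + (s (k + j)%N).2 <= (s k).2.
  elim: j => [|j IH]; first by rewrite addn0 subrr norm_on0 // add0r.
  rewrite addnS; have [h1 h2 _] := sP (k + j)%N.
  have := norm_on_trans nFP (s (k + j)%N).1 (s (k + j).+1).1 (s k).1; lra.
(* The limit lies in every ball of the sequence, by nestedness. *)
have lnear k : nF (l - (s k).1) <= (s k).2.
  apply: (@le_halfX_lim _ _ `|N|) => j.
  have := norm_on_trans nFP (s (k + j)%N).1 l (s k).1.
  have := snest j k; have := s0 (k + j)%N; have := lP (k + j)%N.
  have : N * 2^-1 ^+ (k + j) <= `|N| * 2^-1 ^+ j.
    apply: (@le_trans _ _ (`|N| * 2^-1 ^+ (k + j))).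
      by apply: ler_wpM2r; [exact/ltW/halfX_gt0 | exact: ler_norm].
    apply: ler_wpM2l => //; rewrite exprD ler_piMl ?halfX_le1 //.
  by lra.
have [x xl] := Asurj l.
have xk : nE x <= (Num.bound (nE x))%:R.
  by apply/ltW/archi_boundP; exact: norm_on_ge0.
have [_ _ /(_ x xk)] := sP (Num.bound (nE x)).
by rewrite xl norm_onB // ltNge lnear.
Qed.

(** Subtracting approximate preimages of [y + y0] and of [y0] moves the dense ball to the origin and
    doubles the bound on the preimage. Scaling [y] to norm [r] then gives [M = 2 * k / r]. *)
Lemma approximate_preimage : exists M : R, 0 <= M /\ forall y e, 0 < e ->
  exists x, nE x <= M * nF y /\ nF (y - A x) <= e.
Proof.
have [k [y0 [r [r0 h]]]] := image_ball_somewhere_dense.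
have h0 y e : nF y <= r -> 0 < e ->
    exists x, nE x <= 2 * k%:R /\ nF (y - A x) <= e.
  move=> yr e0; have e2 : 0 < e / 2 by lra.
  have [|x1 [n1 d1]] := h (y + y0) _ _ e2; first by rewrite addrK.
  have [|x2 [n2 d2]] := h y0 _ _ e2; first by rewrite subrr norm_on0 // ltW.
  exists (x1 - x2); split.
    by have := norm_onD nEP x1 (- x2); rewrite norm_onN //; lra.
  have := norm_onD nFP (y + y0 - A x1) (- (y0 - A x2)).
  rewrite norm_onN //.
  have -> : y + y0 - A x1 - (y0 - A x2) = y - A (x1 - x2).
    rewrite [A (_ - _)]linearB !opprB [A x2 - y0]addrC addrACA addrK.
    by rewrite [- A x1 + _]addrC.
  by lra.
exists (2 * k%:R / r); split; first by rewrite !mulr_ge0 // invr_ge0 ltW.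
move=> y e e0; have [->|y0'] := eqVneq y 0.
  exists 0; rewrite linear0 subrr (norm_on0 nEP) (norm_on0 nFP) mulr0.
  by split=> //; exact: ltW.
have ny : 0 < nF y by exact: norm_on_gt0.
pose t := r / nF y; have t0 : 0 < t by rewrite divr_gt0.
have tC : t%:C != 0.
  by rewrite -(rmorph0 (real_complex R)) (inj_eq (@complexI R)) gt_eqF.
have nt : normc t%:C = t by rewrite normc_real gtr0_norm.
have [||x [xk xd]] := h0 (t%:C *: y) (t * e).
- by rewrite norm_onZ // nt /t divfK ?gt_eqF.
- exact: mulr_gt0.
exists (t%:C^-1 *: x); rewrite norm_onZ // normcV nt; split.
  rewrite mulrC ler_pdivrMr //.
  suff -> : 2 * k%:R / r * nF y * t = 2 * k%:R by [].
  by rewrite /t; field; rewrite !gt_eqF.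
have -> : y - A (t%:C^-1 *: x) = t%:C^-1 *: (t%:C *: y - A x).
  by rewrite scalerBr linearZ scalerA mulVf // scale1r.
by rewrite norm_onZ // normcV nt mulrC ler_pdivrMr // mulrC.
Qed.

(** Successive approximation: each stage approximately solves for the current residue and leaves at
    most [nF y] times the next power of 1/2. The corrections sum to an exact preimage, with norm
    bounded by a geometric series of sum [2 * M * nF y]. *)
Lemma open_mapping : exists M : R, 0 <= M /\ forall y,
  exists x, A x = y /\ nE x <= M * nF y.
Proof.
have [M [M0 h]] := approximate_preimage.
exists (2 * M); split; first by rewrite mulr_ge0.
move=> y; have [->|y0] := eqVneq y 0.
  by exists 0; rewrite linear0 (norm_on0 nEP) (norm_on0 nFP) mulr0.
have ny : 0 < nF y by exact: norm_on_gt0.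
have ne k : 0 < nF y * 2^-1 ^+ k by rewrite mulr_gt0 // halfX_gt0.
have step (p : nat * E) : exists x, nE x <= M * nF (y - A p.2) /\
    nF (y - A p.2 - A x) <= nF y * 2^-1 ^+ p.1.+1 by exact: h.
have [f fP] := choice step.
pose s := fix s k : E := if k is j.+1 then s j + f (j, s j) else 0.
have res k : nF (y - A (s k)) <= nF y * 2^-1 ^+ k.
  case: k => [|k]; first by rewrite /= linear0 subr0 expr0 mulr1.
  by rewrite /= linearD opprD addrA; have [] := fP (k, s k).
have sS k : nE (s k.+1 - s k) <= M * nF y * 2^-1 ^+ k.
  rewrite /= addrAC subrr add0r; have [/= h1 _] := fP (k, s k).
  by apply: (le_trans h1); rewrite -mulrA; apply: ler_wpM2l.
have sb k : nE (s k) <= 2 * M * nF y * (1 - 2^-1 ^+ k).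
  elim: k => [|k IH]; first by rewrite /= norm_on0 // expr0 subrr mulr0.
  have := norm_onD nEP (s k.+1 - s k) (s k); rewrite subrK.
  by have := sS k; rewrite exprS; lra.
have [l [N lP]] := cE sS.
exists l; split.
  have /eqP : nF (y - A l) = 0.
    apply/eqP; rewrite eq_le norm_on_ge0 // andbT.
    apply: (@le_halfX_lim _ _ (nF y + L * N)) => k; rewrite add0r.
    have := norm_on_trans nFP (A (s k)) y (A l); have := res k.
    have := AL (s k - l); rewrite [A (_ - _)]linearB (norm_onB nEP (s k)).
    have := ler_wpM2l L0 (lP k); lra.
  by move=> /eqP /(norm_on_eq0 nFP) /eqP; rewrite subr_eq0 => /eqP.
apply: (@le_halfX_lim _ _ N) => k.
have := norm_onD nEP (l - s k) (s k); rewrite subrK; have := lP k; have := sb k.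
have : 0 <= 2 * M * nF y * 2^-1 ^+ k.
  by rewrite !mulr_ge0 // ?ltW // halfX_gt0.
by rewrite mulrBr mulr1; lra.
Qed.

End OpenMapping.

(** The iterates of [z |-> y + K z] from 0 are the partial sums of the Neumann series of [y], with
    steps halving in norm. *)
Lemma contraction_fixpoint (F : lmodType R[i]) (nF : F -> R)
    (nFP : norm_on nF) (cF : complete_norm nF) (K : {linear F -> F}) :
  (forall y, nF (K y) <= 2^-1 * nF y) ->
  forall y, exists z, z - K z = y.
Proof.
move=> Kh y; pose s k := iter k (fun z => y + K z) 0.
have sS k : nF (s k.+1 - s k) <= nF y * 2^-1 ^+ k.
  elim: k => [|k IH]; first by rewrite /= linear0 addr0 subr0 expr0 mulr1.
  have -> : s k.+2 - s k.+1 = K (s k.+1 - s k).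
    by rewrite linearB /= opprD addrACA subrr add0r.
  by apply: (le_trans (Kh _)); rewrite exprS; lra.
have [l [N lP]] := cF _ _ sS.
exists l; apply/eqP; rewrite -subr_eq0; apply/eqP; apply: (norm_on_eq0 nFP).
apply/eqP; rewrite eq_le norm_on_ge0 // andbT.
apply: (@le_halfX_lim _ _ N) => k; rewrite add0r.
have -> : l - K l - y = (l - s k.+1) - K (l - s k).
  by rewrite [K (_ - _)]linearB /= !opprD opprK addrACA subrK.
have := norm_onD nFP (l - s k.+1) (- K (l - s k)); rewrite norm_onN //.
have := Kh (l - s k); have := lP k; have := lP k.+1; rewrite exprS; lra.
Qed.

End Complete.

(** * Bounded generalized inverses *)

Lemma linear_pack (K : numFieldType) (E F : lmodType K) (f : E -> F) :
  linear f -> exists g : {linear E -> F}, forall x, g x = f x.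
Proof.
move=> lf; pose g : {linear E -> F} :=
  HB.pack f (GRing.isLinear.Build K E F *:%R f lf).
by exists g.
Qed.

Lemma cauchy_seq_cvg (K : numFieldType) (X : completeNormedModType K)
    (u : nat -> X) :
  (forall e : K, 0 < e -> exists N, forall n, (N <= n)%N -> `|u N - u n| < e) ->
  exists l, forall e : K, 0 < e ->
    exists N, forall n, (N <= n)%N -> `|l - u n| < e.
Proof.
move=> cu; have /cauchy_cvg : cauchy (u @ \oo).
  apply: cauchy_exP => e e0; have [N NP] := cu e e0.
  by exists (u N); exists N => // n /= /NP; rewrite -ball_normE.
move=> /cvgrPdist_lt ul; exists (lim (u @ \oo)) => e /ul[N _ NP].
by exists N => n Nn; exact: NP.
Qed.

(** Stated over an abstract [K], like [open_nbhs0], so that the topology of [K] is found. *)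
Lemma open_nbhs0_ball (K : numFieldType) (U : set K) (r : K) :
  0 < r -> open_nbhs0 U -> open_nbhs0 (U `&` [set l | `|l| < r]).
Proof.
move=> r0 [oU U0]; split; last by split=> //=; rewrite normr0.
apply: openI => //; have -> : [set l : K | `|l| < r] = ball (0 : K) r.
  by apply/seteqP; split=> l; rewrite -ball_normE /= sub0r normrN.
exact: ball_open.
Qed.

(** * From norms with complex values to real-valued norms *)

Section Transfer.
Context {R : realType}.

Lemma halfX_small (c e : R) : 0 < e -> exists k, c * 2^-1 ^+ k < e.
Proof.
move=> e0; apply: contrapT => h.
suff : e <= 0 by lra.
apply: (@le_halfX_lim _ _ _ c) => k; rewrite add0r leNgt; apply/negP => ck.
by apply: h; exists k.
Qed.

Lemma normcE (z : R[i]) : `|z| = (normc z)%:C.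
Proof. by []. Qed.

Definition rnorm {X : normedModType R[i]} (x : X) : R := complex.Re `|x|.

Lemma rnormE (X : normedModType R[i]) (x : X) : `|x| = (rnorm x)%:C.
Proof. by rewrite /rnorm RRe_real // normr_real. Qed.

Lemma norm_on_rnorm (X : normedModType R[i]) : norm_on (@rnorm X).
Proof.
split=> [x y|c x|x x0].
- by rewrite -lecR rmorphD /= -!rnormE ler_normD.
- by apply: complexI; rewrite rmorphM /= -!rnormE normrZ.
- by apply/normr0_eq0; rewrite rnormE x0.
Qed.

Lemma gt0_complex (e : R[i]) : 0 < e -> 0 < complex.Re e /\
  e = (complex.Re e)%:C.
Proof. by case: e => a b; rewrite ltcE /= => /andP[/eqP -> ->]. Qed.

Lemma complete_rnorm (X : completeNormedModType R[i]) : complete_norm (@rnorm X).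
Proof.
have nP := norm_on_rnorm X; move=> u M uM.
have M0 : 0 <= M.
  have := uM 0; rewrite expr0 mulr1; apply: le_trans; exact: norm_on_ge0.
(* The right-hand side is the exact sum of the bounds on the [j] steps following [k]. *)
have uj j k : rnorm (u (k + j)%N - u k) <= 2 * M * 2^-1 ^+ k * (1 - 2^-1 ^+ j).
  elim: j => [|j IH]; first by rewrite addn0 subrr norm_on0 // expr0 subrr mulr0.
  have := norm_on_trans nP (u (k + j)%N) (u (k + j.+1)%N) (u k).
  by have := uM (k + j)%N; rewrite addnS exprS exprD; lra.
have ub j k : rnorm (u (k + j)%N - u k) <= 2 * M * 2^-1 ^+ k.
  apply: (le_trans (uj j k)); apply: ler_piMr.
    by rewrite !mulr_ge0 //; exact/ltW/halfX_gt0.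
  by have := @halfX_gt0 R j; lra.
have [e /gt0_complex[e0 ->]|l lP] := @cauchy_seq_cvg _ X u.
  have [k ke] := halfX_small (2 * M) e0.
  exists k => n kn; rewrite rnormE ltcR norm_onB //.
  by rewrite -(subnKC kn); exact: le_lt_trans (ub _ _) ke.
exists l, (2 * M) => k; apply: (@le_halfX_lim _ _ _ 1) => j; rewrite mul1r.
have /lP[N NP] : 0 < ((2^-1 : R) ^+ j)%:C by rewrite ltcR halfX_gt0.
have := NP (N + k)%N (leq_addr _ _); rewrite rnormE ltcR.
have := norm_on_trans nP (u (N + k)%N) l (u k).
by have := ub N k; rewrite addnC; lra.
Qed.

Lemma bounded_opP (X Y : normedModType R[i]) (A : X -> Y) :
  bounded_op A <-> exists2 M : R, 0 <= M & forall x, rnorm (A x) <= M * rnorm x.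
Proof.
split=> [[M AM]|[M M0 AM]]; last first.
  by exists M%:C => x; rewrite !rnormE -rmorphM lecR.
(* The bound in [bounded_op] may be any element of [R[i]]; comparing real parts extracts a real
   one. *)
exists `|complex.Re M| => // x; have := AM x; rewrite !rnormE lecE => /andP[_].
have -> : complex.Re (M * (rnorm x)%:C) = complex.Re M * rnorm x.
  by case: M {AM} => a b /=; rewrite mulr0 subr0.
move=> h; apply: (le_trans h); apply: ler_wpM2r; last exact: ler_norm.
exact: (norm_on_ge0 (norm_on_rnorm X)).
Qed.

End Transfer.

(** * Generalized inverses of Fredholm operators and Neumann inversion *)

Section GeneralizedInverse.
Context {R : realType} {E F : lmodType R[i]} {nE : E -> R} {nF : F -> R}.
Hypotheses (nEP : norm_on nE) (nFP : norm_on nF).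
Hypotheses (cE : complete_norm nE) (cF : complete_norm nF).

(** Adding a finite-dimensional complement of R(T) to the source makes [T] surjective, and open
    mapping gives preimages [f y] with a norm bound. Their first components are determined up to
    N(T), and subtracting the projection [p] onto N(T) removes this ambiguity, which makes the
    result linear. *)
Lemma fredholm_generalized_inverse (T : {linear E -> F}) (L : R) :
  0 <= L -> (forall x, nF (T x) <= L * nE x) -> fredholm T ->
  exists (G : {linear F -> E}) (M : R),
    [/\ 0 <= M, forall y, nE (G y) <= M * nF y,
        forall x, T (G (T x)) = T x & forall y, G (T (G y)) = G y].
Proof.
move=> L0 TL [/quotient_dim_neq_None[n dn] /quotient_dim_neq_None[m cm]].
have [e [eN _ eS]] := quotient_dim_basis dn.
have [b [_ bF bS]] := quotient_dim_basis cm.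
have [p [Mp [Mp0 plin pM [prange pe]]]] := bounded_projection nEP e.
have [pl plE] := linear_pack plin.
have pcomb (c : 'I_n -> R[i]) : p (\sum_i c i *: e i) = \sum_i c i *: e i.
  rewrite -plE linear_sum; apply: eq_bigr => i _.
  by rewrite linearZ /= plE pe.
have pN x : T x = 0 -> p x = x.
  move=> /eS[c /eqP]; rewrite subr_eq0 => /eqP ->; exact: pcomb.
have Tp x : T (p x) = 0.
  have [c ->] := prange x; rewrite linear_sum big1 // => i _.
  by rewrite linearZ /= (eN i) scaler0.
pose q x := x - p x.
have qlin : linear q by move=> a x y; rewrite /q plin scalerBr opprD addrACA.
(* [q] vanishes on N(T), so [q x] depends on [T x] only. *)
have qN x x' : T x = T x' -> q x = q x'.
  move=> Txx; have := pN (x - x'); rewrite linearB Txx subrr -plE linearB !plE.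
  move=> /(_ erefl) h; apply/eqP; rewrite -subr_eq0 /q opprD addrACA -opprD h.
  by rewrite subrr.
pose A0 (w : (E * 'rV[R[i]]_m)%type) := T w.1 + \sum_i w.2 0 i *: b i.
have A0lin : linear A0.
  move=> a [x c] [x' c']; rewrite /A0 /= linearP scalerDr addrACA; congr (_ + _).
  rewrite scaler_sumr -big_split; apply: eq_bigr => i _.
  by rewrite !mxE scalerDl scalerA.
have [A AE] := linear_pack A0lin.
pose B := \sum_i nF (b i).
have B0 : 0 <= B by apply: sumr_ge0 => i _; exact: norm_on_ge0.
have AL w : nF (A w) <= (L + B) * (nE w.1 + \sum_i normc (w.2 0 i)).
  rewrite AE /A0; apply: (le_trans (norm_onD nFP _ _)).
  have h : nF (\sum_i w.2 0 i *: b i) <= B * \sum_i normc (w.2 0 i).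
    apply: (@le_trans _ _ (\sum_i normc (w.2 0 i) * nF (b i))).
      elim/big_ind2: _ => [|x1 y1 x2 y2 h1 h2|i _].
      + by rewrite (norm_on0 nFP).
      + by apply: (le_trans (norm_onD nFP _ _)); exact: lerD.
      + by rewrite (norm_onZ nFP).
    rewrite mulr_sumr; apply: ler_sum => i _; rewrite mulrC.
    apply: ler_wpM2r; first exact: normc_ge0.
    by rewrite /B (bigD1 i) //= lerDl; apply: sumr_ge0 => j _; exact: norm_on_ge0.
  have := TL w.1; have := norm_on_ge0 nEP w.1.
  have := norm_on_ge0 (norm_on_row m) w.2; set s := \sum_i normc _ in h * => s0 x0.
  have := mulr_ge0 L0 s0; have := mulr_ge0 B0 x0; lra.
have Asurj y : exists w, A w = y.
  have [c [x _ xy]] := bS y I; exists (x, \row_i c i); rewrite AE /A0 /= xy.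
  rewrite [X in _ + X](eq_bigr (fun i => c i *: b i)) ?subrK // => i _.
  by rewrite mxE.
have [M [M0 h]] := open_mapping (norm_on_prod nEP (norm_on_row m)) nFP
  (complete_prod nEP (norm_on_row m) cE (@complete_row R m)) cF
  (addr_ge0 L0 B0) AL Asurj.
have [f fP] := choice h.
pose G0 y := q (f y).1.
(* Any preimage may replace [f (A w)]: as [b] is free modulo R(T), two preimages have the same
   coordinates on [b], so their first components have the same image under [T]. *)
have G0A w : G0 (A w) = q w.1.
  apply: qN; have : A (f (A w) - w) = 0 by rewrite linearB (fP _).1 subrr.
  rewrite AE /A0 => /eqP; rewrite addrC addr_eq0 => /eqP h0.
  have c0 i : (f (A w) - w).2 0 i = 0.
    apply: (bF (fun i => (f (A w) - w).2 0 i)); rewrite h0.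
    by exists (- (f (A w) - w).1) => //; rewrite linearN.
  move: h0; rewrite big1 => [/esym/eqP|i _]; last by rewrite c0 scale0r.
  by rewrite oppr_eq0 linearB subr_eq0 => /eqP.
have G0lin : linear G0.
  move=> a y y'; rewrite -{1}(fP y).1 -{1}(fP y').1 -linearP G0A.
  by rewrite /= qlin.
have [G GE] := linear_pack G0lin.
have GT x : G (T x) = q x.
  have -> : T x = A (x, 0).
    by rewrite AE /A0 /= big1 ?addr0 // => i _; rewrite mxE scale0r.
  by rewrite GE G0A.
have Tq x : T (q x) = T x by rewrite linearB Tp subr0.
exists G, ((1 + Mp) * M); split.
- by rewrite mulr_ge0 // addr_ge0.
- move=> y; rewrite GE /G0 /q; apply: (le_trans (norm_onD nEP _ _)).
  rewrite norm_onN //; have := pM (f y).1; have [_] := fP y.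
  have := norm_on_ge0 (norm_on_row m) (f y).2; move=> /= r0 r1 r2.
  have : (1 + Mp) * nE (f y).1 <= (1 + Mp) * (M * nF y).
    by apply: ler_wpM2l; lra.
  lra.
- by move=> x; rewrite GT Tq.
- by move=> y; rewrite GT GE /G0; apply: qN; exact: Tq.
Qed.

(** The map [1 - K] is onto by the fixed point lemma and injective by contraction; its inverse is
    then linear. The factor 2 comes from [nF (h y) <= nF y + nF (h y) / 2]. *)
Lemma contraction_inverse (K : {linear F -> F}) :
  (forall y, nF (K y) <= 2^-1 * nF y) ->
  exists H : {linear F -> F},
    [/\ forall y, H y - K (H y) = y, forall z, H (z - K z) = z &
        forall y, nF (H y) <= 2 * nF y].
Proof.
move=> Kh; have [h hP] := choice (contraction_fixpoint nFP cF Kh).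
have inj z z' : z - K z = z' - K z' -> z = z'.
  move=> zz; apply/eqP; rewrite -subr_eq0; apply/eqP/(norm_on_eq0 nFP)/eqP.
  rewrite eq_le norm_on_ge0 // andbT.
  have : z - z' = K (z - z').
    apply/eqP; rewrite -subr_eq0 [K _]linearB opprD addrACA -opprD zz.
    by rewrite subrr.
  by move=> zK; have := Kh (z - z'); rewrite -zK; lra.
have hlin : linear h.
  move=> a y y'; apply: inj; rewrite hP linearP opprD addrACA -scalerBr.
  by rewrite !hP.
have [H HE] := linear_pack hlin.
exists H; split=> [y|z|y]; rewrite !HE; [exact: hP|by apply: inj; rewrite hP|].
have := norm_onD nFP (h y - K (h y)) (K (h y)); rewrite subrK hP.
by have := Kh (h y); lra.
Qed.

End GeneralizedInverse.

(** * Generalized resolvents of a pencil *)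

Section Pencil.
Context {K : numFieldType} {X Y : lmodType K} (T S : {linear X -> Y}).

Lemma pencil_linear l : linear (pencil T S l).
Proof.
move=> a x y; rewrite /pencil (linearP T) (linearP S) scalerDr opprD addrACA.
by rewrite scalerBr !scalerA mulrC.
Qed.

HB.instance Definition _ l :=
  GRing.isLinear.Build K X Y *:%R (pencil T S l) (pencil_linear l).

Lemma pencil0 : pencil T S 0 = T.
Proof. by apply/funext => x; rewrite /pencil scale0r subr0. Qed.

End Pencil.

(** [A \o G] is a projection with range R(A) and null space N(G). *)
Lemma complements_generalized_inverse (K : numFieldType) (X Y : lmodType K)
    (A : {linear X -> Y}) (G : {linear Y -> X}) :
  A \o G \o A =1 A -> G \o A \o G =1 G ->
  complements (range A) (null_space G).
Proof.
move=> AGA GAG; split=> [v|_ [x _ <-] GAx].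
  exists (v - A (G v)); last by rewrite opprB addrC subrK; exists (G v).
  by rewrite /null_space /= linearB; have /= -> := GAG v; rewrite subrr.
by have /= <- := AGA x; rewrite GAx linear0.
Qed.

Lemma generalized_resolvent_codim (K : numFieldType) (X Y : normedModType K)
    (T S : {linear X -> Y}) (U : set K) (G : K -> {linear Y -> X}) :
  U 0 -> generalized_resolvent T S U G ->
  forall l, U l -> codim (range (pencil T S l)) = codim (range T).
Proof.
move=> U0 [_ AGA GAG Gres] l Ul.
(* If [G m1 y = 0], the resolvent identity for [m2] and [m1] reduces to [G m2 y = 0]. *)
have sub m1 m2 : U m1 -> U m2 -> null_space (G m1) `<=` null_space (G m2).
  move=> Um1 Um2 y Gy; have := Gres m2 m1 Um2 Um1 y.
  by rewrite Gy !(linear0, addr0).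
have -> : range T = range (pencil T S 0) by rewrite pencil0.
have NE : null_space (G l) = null_space (G 0).
  by apply/seteqP; split; exact: sub.
apply: (@complements_codim _ _ _ _ (null_space (G 0))).
- exact: subspace_range.
- exact: subspace_range.
- exact: subspace_null_space.
- rewrite -NE; apply: complements_generalized_inverse; [exact: AGA|exact: GAG].
- by apply: complements_generalized_inverse; [exact: AGA|exact: GAG].
Qed.

(* The pencil need not satisfy P G P = P in general: this is exactly what the
   dimension condition enforces, since R(P) meets N(G) = N(G0) in a space of
   dimension codim R(T) - codim R(P) = dim N(T) - dim N(P). *)
Lemma pencil_inner_inverse (K : numFieldType) (X Y : lmodType K)
    (T P : {linear X -> Y}) (G0 G : {linear Y -> X}) :
  T \o G0 \o T =1 T -> G0 \o T \o G0 =1 G0 -> G \o P \o G =1 G ->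
  (forall y, G y = 0 <-> G0 y = 0) -> (forall y, exists z, G z = G0 y) ->
  fredholm T ->
  dim (null_space P) = dim (null_space T) \/ codim (range P) = codim (range T) ->
  P \o G \o P =1 P.
Proof.
move=> TGT GTG GPG NG RG [fN fR] [dN|cR] x /=.
  (* The projection [1 - G0 T] maps into N(T). It is injective on N(G P): if [u = G0 (T u)], then
     [u] is some [G z], and [G (P u) = 0] gives [u = G (P (G z)) = 0]. *)
  have flin : linear (fun x => x - G0 (T x)).
    move=> a u v; rewrite (linearP T) (linearP G0) scalerBr opprD.
    by rewrite addrACA.
  have [f fE] := linear_pack flin.
  have : null_space (G \o P) `<=` null_space P.
    apply: (@subset_of_dim _ _ _ f (null_space T)) => //.
    - exact: subspace_null_space.
    - exact: subspace_null_space.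
    - by move=> u; rewrite /null_space /= => ->; rewrite linear0.
    - move=> u _; rewrite /null_space /= fE linearB.
      by have /= -> := TGT u; rewrite subrr.
    - move=> u; rewrite /null_space /= fE => Gu /eqP; rewrite subr_eq0 => /eqP uE.
      have [z zE] := RG (T u); rewrite uE -zE; have /= <- := GPG z.
      by rewrite zE -uE.
  move=> /(_ (x - G (P x))); rewrite /null_space /= !linearB.
  have /= -> := GPG (P x); rewrite subrr => /(_ erefl)/eqP.
  by rewrite subr_eq0 => /eqP.
(* The difference of [P (G (P x))] and [P x] lies in R(P) and in N(G0), which meet trivially. *)
apply/eqP; rewrite -subr_eq0; apply/eqP.
apply: (@trivial_meet_of_codim _ _ (range T) (range P) (null_space G0)) => //.
- exact: subspace_range.
- exact: subspace_range.
- exact: subspace_null_space.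
- exact: complements_generalized_inverse.
- move=> v; exists (v - P (G v)).
    by apply/NG; rewrite linearB; have /= -> := GPG v; rewrite subrr.
  by rewrite opprB addrC subrK; exists (G v).
- by rewrite -linearB; exists (G (P x) - x).
- by apply/NG; rewrite linearB; have /= -> := GPG (P x); rewrite subrr.
Qed.

Section Resolvent.
Context {R : realType} {X Y : normedModType R[i]} (T S : {linear X -> Y}).

(* Iterating the resolvent identity expands G around every point of U. *)
Lemma generalized_resolvent_analytic (U : set R[i]) (G : R[i] -> {linear Y -> X}) :
  bounded_op S -> generalized_resolvent T S U G -> analytic_on U G.
Proof.
move=> /bounded_opP[MS MS0 SM] [Gb _ _ Gres] m Um.
have /bounded_opP[MG MG0 GM] := Gb m Um.
pose B y := S (G m y).
have BM y : rnorm (B y) <= MS * MG * rnorm y.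
  apply: (le_trans (SM _)); rewrite -mulrA; exact: ler_wpM2l.
(* The added 1 keeps the radius [(2 * M)^-1] well defined; within it [M] times the distance from [l]
   to [m] is at most 1/2. *)
pose M := MS * MG + 1; have M1 : 1 <= M by rewrite lerDr mulr_ge0.
have nY y : 0 <= rnorm (y : Y) by exact: (norm_on_ge0 (norm_on_rnorm Y)).
have BkM k y : rnorm (iter k B y) <= M ^+ k * rnorm y.
  elim: k => [|k IH]; first by rewrite expr0 mul1r.
  apply: (le_trans (BM _)); apply: (@le_trans _ _ (M * rnorm (iter k B y))).
    by apply: ler_wpM2r => //; rewrite lerDl.
  by rewrite exprS -mulrA; apply: ler_wpM2l => //; lra.
have Aex k : exists A : {linear Y -> X}, forall y, A y = G m (iter k B y).
  apply: linear_pack; elim: k => [|k IH] a y z; first exact: linearP.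
  have it u : iter k.+1 B u = iter k B (B u) by rewrite iterSr.
  by rewrite !it /B -IH (linearP (G m)) (linearP S).
have [A AE] := choice Aex.
exists ((2 * M)^-1%:C), A; split.
- by rewrite ltcR invr_gt0; lra.
- move=> k; apply/bounded_opP; exists (MG * M ^+ k).
    by rewrite mulr_ge0 // exprn_ge0 //; lra.
  move=> y; rewrite AE; apply: (le_trans (GM _)); rewrite -mulrA.
  exact: ler_wpM2l.
move=> l Ul lm e /gt0_complex[e0 ->].
(* The remainder is exact, with [G l] in place of [G m]; its bound [ML] depends on [l] but not on
   [n]. *)
have expand n y : G l y - \sum_(k < n) (l - m) ^+ k *: A k y =
    (l - m) ^+ n *: G l (iter n B y).
  elim: n => [|n IH]; first by rewrite big_ord0 subr0 expr0 scale1r.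
  rewrite big_ord_recr opprD addrA IH AE -scalerBr Gres // scalerA -exprSr.
  by [].
have /bounded_opP[ML ML0 LM] := Gb l Ul.
have [N NP] := halfX_small ML e0.
exists N => // n /= Nn y; rewrite expand !rnormE -rmorphM lecR.
rewrite (norm_onZ (norm_on_rnorm X)).
have -> : normc ((l - m) ^+ n) = normc (l - m) ^+ n.
  by elim: (n) => [|k IH]; rewrite ?expr0 ?normc1 // !exprS normcM IH.
have lM : normc (l - m) * M <= 2^-1.
  have : normc (l - m) < (2 * M)^-1 by rewrite -ltcR -normcE.
  by rewrite -[_^-1]mul1r ltr_pdivlMr; lra.
have a0 := normc_ge0 (l - m).
have lMn : normc (l - m) ^+ n * M ^+ n <= 2^-1 ^+ N.
  rewrite -exprMn; apply: (@le_trans _ _ (2^-1 ^+ n)).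
    by apply: lerXn2r => //; rewrite nnegrE ?mulr_ge0; lra.
  by apply: ler_wiXn2l => //; lra.
apply: (@le_trans _ _ (normc (l - m) ^+ n * (ML * (M ^+ n * rnorm y)))).
  apply: ler_wpM2l; first exact: exprn_ge0.
  by apply: (le_trans (LM _)); exact: ler_wpM2l.
rewrite mulrCA !mulrA; apply: ler_wpM2r => //; rewrite -mulrA.
by apply: le_trans (ltW NP); exact: ler_wpM2l.
Qed.

End Resolvent.

(** * Construction of the resolvent near 0 *)

Section NeumannResolvent.
Context {R : realType} {X Y : completeNormedModType R[i]} (T S : {linear X -> Y}).

Lemma fredholm_pencil_resolvent :
  bounded_op T -> bounded_op S -> fredholm T ->
  exists (r : R) (G : R[i] -> {linear Y -> X}), 0 < r /\
    forall U : set R[i], (forall l, U l -> normc l < r) ->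
    (forall l, U l -> dim (null_space (pencil T S l)) = dim (null_space T) \/
      codim (range (pencil T S l)) = codim (range T)) ->
    generalized_resolvent T S U G.
Proof.
move=> /bounded_opP[MT MT0 TM] /bounded_opP[MS MS0 SM] fT.
have nX := norm_on_rnorm X; have nY := norm_on_rnorm Y.
have [G0 [M [M0 GM TGT GTG]]] := fredholm_generalized_inverse nX nY
  (complete_rnorm (X := X)) (complete_rnorm (X := Y)) MT0 TM fT.
(* For [l] of modulus below [r], the operator [l S G0] is a contraction with factor 1/2. *)
pose r := (2 * (MS * M + 1))^-1.
have D0 : 0 < MS * M + 1 by rewrite ltr_pwDr // mulr_ge0.
have r0 : 0 < r by rewrite invr_gt0 mulr_gt0.
(* [H] is the inverse of [1 - l S G0]; outside the disc the identity is a dummy value that makes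
   [choice] applicable. *)
have Hex (l : R[i]) : exists H : {linear Y -> Y}, normc l < r ->
    [/\ forall y, H y - l *: S (G0 (H y)) = y,
        forall z, H (z - l *: S (G0 z)) = z &
        forall y, rnorm (H y) <= 2 * rnorm y].
  have [lr|_] := ltP (normc l) r; last by exists idfun.
  have Klin : linear (fun y => l *: S (G0 y)).
    by move=> a y z; rewrite (linearP G0) (linearP S) scalerDr !scalerA mulrC.
  have [K KE] := linear_pack Klin.
  have [|H [H1 H2 H3]] := @contraction_inverse _ _ _ nY (complete_rnorm (X := Y)) K.
    move=> y; rewrite KE (norm_onZ nY).
    have h : rnorm (S (G0 y)) <= (MS * M + 1) * rnorm y.
      apply: (le_trans (SM _)); have := ler_wpM2l MS0 (GM y).
      by have := norm_on_ge0 nY y; lra.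
    apply: (@le_trans _ _ (r * ((MS * M + 1) * rnorm y))).
      by apply: ler_pM => //; [exact: normc_ge0|exact: (norm_on_ge0 nY)|exact: ltW].
    suff -> : r * ((MS * M + 1) * rnorm y) = 2^-1 * rnorm y by [].
    by rewrite /r; field; rewrite gt_eqF.
  exists H => _; split=> [y|z|//]; first by rewrite -KE H1.
  by rewrite -KE H2.
have [H HP] := choice Hex.
have Gex l : exists G : {linear Y -> X}, forall y, G y = G0 (H l y).
  by apply: linear_pack => a y z; rewrite (linearP (H l)) (linearP G0).
have [G GE] := choice Gex.
exists r, G; split=> // U Ur UD.
(* Where [G0 z = 0], the operator [1 - l S G0] fixes [z]. Either hypothesis thus forces
   [H l y = y]. *)
have NG l : normc l < r -> forall y, G l y = 0 <-> G0 y = 0.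
  move=> /HP[H1 H2 _] y; rewrite GE; split=> Gy.
    by have := H1 y; rewrite Gy !(linear0, addr0) => <-.
  by have := H2 y; rewrite Gy !(linear0, addr0) => ->.
have GPG l : normc l < r -> G l \o pencil T S l \o G l =1 G l.
  move=> lr y /=; have [H1 H2 _] := HP l lr.
  have : G l (T (G0 (H l y)) - H l y) = 0.
    by apply/(NG l lr); rewrite linearB GTG subrr.
  (* Since [y = H l y - l S G0 (H l y)], the term in [S] equals [y - H l y]. What is added to [y]
     lies in N(G0), hence is killed by [G l]. *)
  have -> : pencil T S l (G l y) = T (G0 (H l y)) - H l y + y.
    by rewrite /pencil GE -[X in _ = _ + X](H1 y) addrA subrK.
  by move=> d; rewrite [LHS]linearD d add0r.
split=> [l /Ur lr|l Ul|l /Ur lr|l m /Ur lr /Ur mr y].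
- have [_ _ H3] := HP l lr; apply/bounded_opP; exists (M * 2).
    by rewrite mulr_ge0.
  by move=> y; rewrite GE; apply: (le_trans (GM _)); rewrite -mulrA ler_wpM2l.
- have lr := Ur l Ul.
  apply: (pencil_inner_inverse (G0 := G0) (T := T)) => //.
  + exact: GPG.
  + exact: NG.
  + move=> y; exists (y - l *: S (G0 y)); rewrite GE.
    by have [_ -> _] := HP l lr.
  + exact: UD.
- exact: GPG.
- have [Hl1 Hl2 _] := HP l lr; have [Hm1 _ _] := HP m mr.
  transitivity (G0 (H l ((l - m) *: S (G0 (H m y))))); last first.
    by rewrite !GE !linearZ.
  (* This is the second resolvent identity for [H]: applying [1 - l S G0] to [H l y - H m y] leaves
     [(l - m) S G0 (H m y)]. *)
  rewrite !GE -linearB; congr (G0 _); rewrite -[LHS]Hl2; congr (H l _).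
  have -> : S (G0 (H l y - H m y)) = S (G0 (H l y)) - S (G0 (H m y)).
    by rewrite (linearB G0) (linearB S).
  rewrite scalerBr opprD addrACA -opprD Hl1 -[X in X - _ = _](Hm1 y) scalerBl.
  by rewrite opprD opprK addrACA subrr add0r addrC.
Qed.

End NeumannResolvent.

Theorem theorem2p4 (R : realType) (X Y : completeNormedModType R[i])
    (T S : {linear X -> Y}) (bT : bounded_op T) (bS : bounded_op S)
    (fT : fredholm T) :
  (exists U : set R[i], open_nbhs0 U /\
    exists G : R[i] -> {linear Y -> X}, analytic_generalized_resolvent T S U G)
  <->
  (exists U : set R[i], open_nbhs0 U /\
    forall l : R[i], U l ->
      dim (null_space (pencil T S l)) = dim (null_space T) \/
      codim (range (pencil T S l)) = codim (range T)).
Proof.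
split=> [[U [U0 [G [Gres _]]]]|[U [U0 UD]]].
  exists U; split=> // l Ul; right.
  by apply: (generalized_resolvent_codim _ Gres) => //; exact: U0.2.
have [r [G [r0 GP]]] := fredholm_pencil_resolvent bT bS fT.
exists (U `&` [set l | `|l| < r%:C]); split.
  by apply: open_nbhs0_ball => //; rewrite ltcR.
have Gres : generalized_resolvent T S (U `&` [set l | `|l| < r%:C]) G.
  apply: GP => l [Ul] /=; last by move=> _; exact: UD.
  by rewrite normcE ltcR.
exists G; split=> //; exact: generalized_resolvent_analytic Gres.
Qed.
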